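(* Let $\mathbb X$ be a locally compact, separable and metrizable space, $\mathbb Y$ a Polish space, and $C(\mathbb X,\mathbb Y)$ the space of continuous functions $\mathbb X\to\mathbb Y$ equipped with the compact-open topology. Then: (i) The evaluation function $e\colon C(\mathbb X,\mathbb Y)\times\mathbb X\to\mathbb Y$, $(f,x)\mapsto f(x)$, is continuous and therefore measurable. (ii) $\mathbb X$ is hemicompact, i.e. a compact exhaustion of $\mathbb X$ exists. $C(\mathbb X,\mathbb Y)$ is a Polish space, and for any metric $d_{\mathbb Y}$ that generates the topology of $\mathbb Y$ and any compact exhaustion $(K_n)_{n\in\mathbb N}$ of $\mathbb X$, its topology is generated by the metric $$d(f,g):=\sum_{n=1}^\infty2^{-n}\frac{d_n(f,g)}{1+d_n(f,g)}\qquad\text{with}\qquad d_n(f,g):=\sup_{x\in K_n}d_{\mathbb Y}(f(x),g(x)).$$ (iii) The Borel $\sigma$-algebra of $C(\mathbb X,\mathbb Y)$ is equal to the restriction of the product $\sigma$-algebra of $\mathbb Y^{\mathbb X}$ to $C(\mathbb X,\mathbb Y)$, i.e. $\mathcal B(C(\mathbb X,\mathbb Y))=\mathcal B(\mathbb Y)^{\otimes\mathbb X}\big|_{C(\mathbb X,\mathbb Y)}$.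
   Context: The compact-open topology on $C(\mathbb X,\mathbb Y)$ is the smallest topology in which all sets $M(K,U)=\{f\in C(\mathbb X,\mathbb Y):f(K)\subseteq U\}$ with $K\subseteq\mathbb X$ compact and $U\subseteq\mathbb Y$ open are open. A compact exhaustion of $\mathbb X$ is a sequence $(K_n)_{n\in\mathbb N}$ of compact sets such that $K_n$ is contained in the interior of $K_{n+1}$ for every $n$ and $\mathbb X=\bigcup_{n}K_n$; $\mathbb X$ is called hemicompact if a compact exhaustion exists. (The supremum of the empty set is taken to be $0$.) $\mathcal B(\cdot)$ denotes the Borel $\sigma$-algebra; $\mathcal B(\mathbb Y)^{\otimes\mathbb X}$ is the smallest $\sigma$-algebra on $\mathbb Y^{\mathbb X}$ making all projections $f\mapsto f(x)$, $x\in\mathbb X$, measurable, and the bar denotes the trace $\sigma$-algebra. *)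

(* Defs.v *)
From HB Require Import structures.
From mathcomp Require Import all_boot all_order all_algebra.
From mathcomp Require Import all_classical all_reals all_analysis.

Set Implicit Arguments.
Unset Strict Implicit.
Unset Printing Implicit Defensive.

Import Order.TTheory GRing.Theory Num.Theory.
Import numFieldNormedType.Exports.
Import ArrowAsCompactOpen.

Local Open Scope classical_set_scope.
Local Open Scope ring_scope.

(* None of the spaces below is assumed to be inhabited. For this reason
   sigma-algebras are handled as sets of sets: the library's
   [g_sigma_algebraType] requires a pointed carrier. *)

Definition separable (T : topologicalType) : Prop :=
  exists2 D : set T, countable D & dense D.

Definition is_metric (R : realType) (T : Type) (d : T -> T -> R) : Prop :=
  [/\ forall x y, 0 <= d x y,
      forall x y, d x y = 0 <-> x = y,
      forall x y, d x y = d y x &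
      forall x y z, d x z <= d x y + d y z].

Definition metric_generates (R : realType) (T : topologicalType)
    (d : T -> T -> R) : Prop :=
  is_metric d /\
  forall U : set T, open U <->
    forall x, U x -> exists2 e : R, 0 < e & [set y | d x y < e] `<=` U.

Definition metrizable (R : realType) (T : topologicalType) : Prop :=
  exists d : T -> T -> R, metric_generates d.

(* The limit is taken in the topology of [T]; the definition is only used for
   metrics generating this topology. *)
Definition complete_metric (R : realType) (T : topologicalType)
    (d : T -> T -> R) : Prop :=
  forall u : nat -> T,
    (forall e : R, 0 < e ->
       exists N, forall m n, (N <= m)%N -> (N <= n)%N -> d (u m) (u n) < e) ->
    exists l : T, u @ \oo --> l.

Definition polish (R : realType) (T : topologicalType) : Prop :=
  separable T /\
  exists d : T -> T -> R, metric_generates d /\ complete_metric d.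

Definition compact_exhaustion (X : topologicalType) (K : nat -> set X) : Prop :=
  [/\ forall n, compact (K n),
      forall n, K n `<=` interior (K n.+1) &
      \bigcup_n K n = [set: X]].

Definition hemicompact (X : topologicalType) : Prop :=
  exists K : nat -> set X, compact_exhaustion K.

(* [reals.sup set0 = 0], in accordance with the convention for empty [K]. *)
Definition dist_on (R : realType) (X Y : topologicalType) (dY : Y -> Y -> R)
    (K : set X) (f g : continuousType X Y) : R :=
  reals.sup [set dY (f x) (g x) | x in K].

(* Indices start at 0 here, so that [K n] and the weight [2 ^- n.+1] are the
   (n+1)-st set and weight of the sum over n >= 1. *)
Definition compact_convergence_dist (R : realType) (X Y : topologicalType)
    (dY : Y -> Y -> R) (K : nat -> set X) (f g : continuousType X Y) : R :=
  limn (series (fun n : nat =>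
    2 ^- n.+1 * (dist_on dY (K n) f g / (1 + dist_on dY (K n) f g)) : R)).

Definition borel (T : topologicalType) : set (set T) :=
  <<s [set U : set T | open U] >>.
Arguments borel : clear implicits.

Definition measurable_wrt (T U : Type) (F : set (set T)) (G : set (set U))
    (f : T -> U) : Prop :=
  forall B, G B -> F (f @^-1` B).

Definition prod_sigma_algebra (T U : Type) (F : set (set T)) (G : set (set U)) :
    set (set (T * U)) :=
  <<s preimage_set_system setT fst F `|` preimage_set_system setT snd G >>.

Definition power_sigma_algebra (X U : Type) (G : set (set U)) :
    set (set (X -> U)) :=
  <<s \bigcup_x preimage_set_system setT (fun f : X -> U => f x) G >>.
Arguments power_sigma_algebra : clear implicits.
Arguments power_sigma_algebra X {U} G.

(* [continuousType X Y] is a type of its own, embedded in [X -> Y] by a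
   coercion, so the trace consists of the preimages under this embedding. *)
Definition trace_continuous (X Y : topologicalType) (F : set (set (X -> Y))) :
    set (set (continuousType X Y)) :=
  preimage_set_system setT (fun f : continuousType X Y => (f : X -> Y)) F.

(* Main.v *)
Require Import Defs.
From HB Require Import structures.
From mathcomp Require Import all_boot all_order all_algebra.
From mathcomp Require Import all_classical all_reals all_analysis.
From mathcomp Require Import lra.

Set Implicit Arguments.
Unset Strict Implicit.
Unset Printing Implicit Defensive.

Import Order.TTheory GRing.Theory Num.Theory.
Import numFieldNormedType.Exports.
(* [continuousType X Y] carries the compact-open topology. *)
Import ArrowAsCompactOpen.

Local Open Scope classical_set_scope.
Local Open Scope ring_scope.

(** Every part rests on two countable families of sets. Being separable and
    metrizable, [X] and [Y] have countable bases, and by local compactness the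
    base [B] of [X] can be chosen with compact closures
    ([locally_compact_base]); finite unions of these closures, spaced out so
    that each lies in the interior of the next, exhaust [X].

    (i) Evaluation is continuous because [X] is locally compact and regular.
    For the product sigma-algebra a countable base of the factor [X] is enough:
    an open subset of a product with [X] is a countable union of boxes
    [W n `*` B n], where [W n] is the largest open set for which the box fits inside
    ([open_prod_sigma_algebra]).

    (ii) Since the distances [dist_on dY (K n)] increase with [n], the series is
    squeezed between its [n]-th term and the [n]-th distance plus
    [2 ^- n.+1] ([weighted_term_le_sum], [weighted_sum_le]). So being close for
    the metric of the series means being uniformly close on some [K n]; the two
    directions are [compact_convergence_dist_uniform] and
    [uniform_compact_convergence_dist], and nothing else about the series is used
    to identify the topology and to transfer completeness from [Y]. Such
    neighbourhoods are compact-open neighbourhoods by continuity of evaluation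
    and compactness of [K n]; conversely, uniform closeness near every point of
    a compact set keeps its image inside an open set. Separability comes from a
    countable base: the sets of functions mapping finitely many [closure (B i)]
    into given members of a countable base of [Y]
    ([compact_open_countable_base]).

    (iii) This base also gives the inclusion from left to right, once
    each condition [f @` closure (B i) `<=` V] is expressed by countably many
    evaluations. By compactness the image keeps a positive distance [2 ^- n]
    from the complement of [V], and by continuity this closed condition only
    has to be tested on a countable dense set ([compact_open_subE]). The other
    inclusion holds because evaluation at a point is continuous. *)

(** * The series of weighted bounded distances *)
Section Saturate.
Context {R : realType}.

Definition saturate (t : R) : R := t / (1 + t).

Lemma saturate0 : saturate 0 = 0.
Proof. by rewrite /saturate mul0r. Qed.

Lemma saturate_ge0 t : 0 <= t -> 0 <= saturate t.
Proof. by move=> t0; rewrite /saturate divr_ge0// addr_ge0. Qed.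

Lemma saturate_gt0 t : 0 < t -> 0 < saturate t.
Proof. by move=> t0; rewrite /saturate divr_gt0// addr_gt0. Qed.

Lemma saturate_le1 t : 0 <= t -> saturate t <= 1.
Proof. by move=> t0; rewrite /saturate ler_pdivrMr; lra. Qed.

Lemma saturate_le_id t : 0 <= t -> saturate t <= t.
Proof. by move=> t0; rewrite /saturate ler_pdivrMr; nra. Qed.

Lemma ler_saturate s t : 0 <= s -> 0 <= t -> (saturate s <= saturate t) = (s <= t).
Proof.
move=> s0 t0; rewrite /saturate ler_pdivrMr; last by lra.
rewrite mulrAC ler_pdivlMr; last by lra.
by apply/idP/idP; nra.
Qed.

Lemma ltr_saturate s t : 0 <= s -> 0 <= t -> (saturate s < saturate t) = (s < t).
Proof. by move=> s0 t0; rewrite !ltNge ler_saturate. Qed.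

Lemma saturate_subadditive r s t :
  0 <= r -> 0 <= s -> 0 <= t -> r <= s + t -> saturate r <= saturate s + saturate t.
Proof.
move=> r0 s0 t0 rst; apply: (@le_trans _ _ (saturate (s + t))).
  by rewrite ler_saturate// addr_ge0.
rewrite /saturate mulrDl lerD// ler_wpM2l// lef_pV2 ?posrE; lra.
Qed.

End Saturate.

Section WeightedSum.
Context {R : realType}.
Implicit Types a b c : nat -> R.

Definition weighted_term a (n : nat) : R := 2 ^- n.+1 * saturate (a n).

(** [compact_convergence_dist dY K f g] is by definition this sum for the sequence
    [fun n => dist_on dY (K n) f g]. *)
Definition weighted_sum a : R := limn (series (weighted_term a)).

Lemma expV2_gt0 n : 0 < 2 ^- n :> R.
Proof. by rewrite invr_gt0 exprn_gt0. Qed.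

Lemma expV2S n : 2 ^- n = 2 ^- n.+1 + 2 ^- n.+1 :> R.
Proof. by rewrite exprS invfM; lra. Qed.

Lemma expV2_small (e : R) : 0 < e -> exists n, 2 ^- n < e.
Proof.
move=> e0.
have : (fun n => 2 ^- n) @ \oo --> (0 : R).
  apply: cvg_trans (cvg_expr (_ : `|2^-1 : R| < 1)); last first.
    by rewrite ger0_norm ?invr_ge0// invf_lt1 ?ltr1n.
  by under eq_fun do rewrite -exprVn.
move=> /cvgrPdist_lt /(_ e e0)[N _ /(_ N)].
rewrite /= leqnn sub0r normrN ger0_norm ?ltW ?expV2_gt0//.
by move=> /(_ isT) ?; exists N.
Qed.

Lemma weighted_term_ge0 a n : (forall n, 0 <= a n) -> 0 <= weighted_term a n.
Proof. by move=> a0; rewrite mulr_ge0 ?saturate_ge0// ltW// expV2_gt0. Qed.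

Lemma nondecreasing_weighted a : (forall n, 0 <= a n) ->
  nondecreasing_seq (series (weighted_term a)).
Proof.
by move=> a0; apply: nondecreasing_series => n _ _; exact: weighted_term_ge0.
Qed.

(** The first [n.+1] terms are at most [2 ^- i.+1 * a n] by monotonicity, and the
    remaining ones are dominated by a geometric tail. *)
Lemma weighted_series_le a n m : (forall n, 0 <= a n) ->
  nondecreasing_seq a -> series (weighted_term a) m <= a n + 2 ^- n.+1.
Proof.
move=> a0 amono.
have head k : (k <= n.+1)%N ->
    series (weighted_term a) k <= a n * (1 - 2 ^- k).
  elim: k => [|k IH] kn.
    by rewrite /series/= big_geq// expr0 invr1 subrr mulr0.
  rewrite seriesSr.
  have : weighted_term a k <= 2 ^- k.+1 * a n.
    apply: ler_wpM2l; first exact: ltW (expV2_gt0 _).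
    by apply: le_trans (saturate_le_id (a0 k)) (amono _ _ _).
  have := IH (ltnW kn); rewrite [2 ^- k]expV2S; lra.
have tail k :
    series (weighted_term a) (n.+1 + k)%N <= a n + 2 ^- n.+1 - 2 ^- (n.+1 + k)%N.
  elim: k => [|k IH].
    rewrite addn0 addrK; apply: (le_trans (head n.+1 (leqnn _))).
    by rewrite ler_piMr// gerBl ltW// expV2_gt0.
  rewrite addnS seriesSr.
  have : weighted_term a (n.+1 + k)%N <= 2 ^- (n.+1 + k)%N.+1.
    by rewrite /weighted_term ler_piMr ?saturate_le1// ltW// expV2_gt0.
  by move: IH; rewrite [2 ^- (n.+1 + k)%N]expV2S; lra.
apply: (le_trans (nondecreasing_weighted a0 (leq_addl n.+1 m))).
by apply: (le_trans (tail m)); rewrite gerBl ltW// expV2_gt0.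
Qed.

Lemma is_cvg_weighted a : (forall n, 0 <= a n) -> nondecreasing_seq a ->
  cvgn (series (weighted_term a)).
Proof.
move=> a0 amono; apply: nondecreasing_is_cvgn; first exact: nondecreasing_weighted.
by exists (a 0 + 2 ^- 1) => _ [m _ <-]; exact: weighted_series_le.
Qed.

Lemma weighted_sum_le a n : (forall n, 0 <= a n) -> nondecreasing_seq a ->
  weighted_sum a <= a n + 2 ^- n.+1.
Proof.
move=> a0 amono; apply: limr_le; first exact: is_cvg_weighted.
by apply: nearW => m; exact: weighted_series_le.
Qed.

Lemma weighted_term_le_sum a n : (forall n, 0 <= a n) -> nondecreasing_seq a ->
  weighted_term a n <= weighted_sum a.
Proof.
move=> a0 amono; apply: (@le_trans _ _ (series (weighted_term a) n.+1)).
  rewrite seriesSr lerDr.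
  by apply: sumr_ge0 => i _; exact: weighted_term_ge0.
apply: nondecreasing_cvgn_le; first exact: nondecreasing_weighted.
exact: is_cvg_weighted.
Qed.

Lemma weighted_sum_ge0 a : (forall n, 0 <= a n) -> nondecreasing_seq a ->
  0 <= weighted_sum a.
Proof.
move=> a0 amono.
exact: le_trans (weighted_term_ge0 0 a0) (weighted_term_le_sum 0 a0 amono).
Qed.

(** A single term already controls [a n], because [saturate] is strictly
    increasing. *)
Lemma weighted_sum_small a n e : (forall n, 0 <= a n) ->
  nondecreasing_seq a -> 0 <= e ->
  weighted_sum a < 2 ^- n.+1 * saturate e -> a n < e.
Proof.
move=> a0 amono e0 /(le_lt_trans (weighted_term_le_sum n a0 amono)).
by rewrite ltr_pM2l ?expV2_gt0// ltr_saturate.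
Qed.

Lemma weighted_sum_eq0 a : (forall n, 0 <= a n) -> nondecreasing_seq a ->
  weighted_sum a = 0 -> forall n, a n = 0.
Proof.
move=> a0 amono wa0 n; apply/eqP; rewrite eq_le a0 andbT leNgt; apply/negP.
move=> an0; have := @weighted_sum_small a n (a n) a0 amono (a0 n).
by rewrite ltxx wa0 mulr_gt0 ?expV2_gt0 ?saturate_gt0//; apply/implyP.
Qed.

Lemma weighted_sum0 : weighted_sum (fun=> 0) = 0.
Proof.
rewrite /weighted_sum /weighted_term saturate0.
under eq_fun do rewrite mulr0.
rewrite (_ : series _ = cst 0) ?lim_cst//.
by apply/funext => n; rewrite /series/= big1.
Qed.

Lemma weighted_sum_subadditive a b c :
  (forall n, 0 <= a n) -> nondecreasing_seq a ->
  (forall n, 0 <= b n) -> nondecreasing_seq b ->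
  (forall n, 0 <= c n) -> nondecreasing_seq c ->
  (forall n, a n <= b n + c n) ->
  weighted_sum a <= weighted_sum b + weighted_sum c.
Proof.
move=> a0 am b0 bm c0 cm abc.
rewrite /weighted_sum -lim_seriesD; [|exact: is_cvg_weighted..].
apply: lim_series_le => [||n]; first exact: is_cvg_weighted.
  by apply: is_cvg_seriesD; exact: is_cvg_weighted.
rewrite -[leRHS]mulrDr; apply: ler_wpM2l; first exact: ltW (expV2_gt0 _).
exact: saturate_subadditive.
Qed.

End WeightedSum.

(** * Metric topologies and countable bases *)
Section MetricTopology.
Context {R : realType} {T : topologicalType} {d : T -> T -> R}.

Lemma is_metric_refl : is_metric d -> forall x, d x x = 0.
Proof. by case=> _ d0 _ _ x; exact/d0. Qed.

Lemma metric_generatesP : is_metric d ->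
  (forall x A, nbhs x A <-> exists2 e : R, 0 < e & [set y | d x y < e] `<=` A) ->
  metric_generates d.
Proof.
move=> dmetric nbhsd; split=> // U; split=> [Uopen x Ux|ballU].
  exact/nbhsd/open_nbhs_nbhs.
by rewrite openE => x Ux; apply/nbhsd/ballU.
Qed.

Hypothesis gen_d : metric_generates d.

Lemma nbhs_metric_ball x (e : R) : 0 < e -> nbhs x [set y | d x y < e].
Proof.
case: gen_d => dmetric dopen e0; have [_ _ _ dtri] := dmetric.
apply: open_nbhs_nbhs; split; last by rewrite /= is_metric_refl.
apply/dopen => y /= dxy; exists (e - d x y); first by rewrite subr_gt0.
by move=> z /= dyz; have := dtri x y z; lra.
Qed.

Lemma nbhs_metricP x A :
  nbhs x A <-> exists2 e : R, 0 < e & [set y | d x y < e] `<=` A.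
Proof.
split=> [|[e e0 eA]]; last exact: filterS eA (nbhs_metric_ball x e0).
rewrite nbhsE => -[U [Uopen Ux] UA].
have [e e0 eU] := (gen_d.2 U).1 Uopen x Ux.
by exists e => //; exact: subset_trans UA.
Qed.

Lemma metric_regular : regular_space T.
Proof.
have [[_ _ dsym dtri] _] := gen_d.
move=> x A /nbhs_metricP[e e0 eA].
exists [set y | d x y < e / 2]; first by apply: nbhs_metric_ball; lra.
move=> y /(_ _ (nbhs_metric_ball y (_ : 0 < e / 2))) []; first by lra.
by move=> z [/= xz yz]; apply: eA => /=; have := dtri x z y; rewrite (dsym z y); lra.
Qed.

Lemma metric_cvgP (u : nat -> T) l :
  (forall e : R, 0 < e -> \forall n \near \oo, d l (u n) < e) -> u @ \oo --> l.
Proof. by move=> ul A /nbhs_metricP[e e0 eA]; apply: filterS (ul e e0) => n /eA. Qed.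

End MetricTopology.

(** Indexing by [nat] keeps countability concrete; repeated or empty members are
    harmless, so that filtering a base amounts to replacing members by [set0]. *)
Definition countable_base (T : topologicalType) (B : nat -> set T) :=
  (forall n, open (B n)) /\
  forall x A, nbhs x A -> exists2 n, B n x & B n `<=` A.

(** The base consists of the balls of radius [2 ^- k] centred at points of a
    countable dense set. A centre is named by its value under an injection into
    [nat], which avoids choosing an enumeration, impossible when [T] is empty. *)
Lemma separable_metrizable_base (R : realType) (T : topologicalType) :
  separable T -> metrizable R T -> exists B : nat -> set T, countable_base B.
Proof.
move=> [D /countable_injP[f finj] Ddense] [d gen_d].
have [[_ _ dsym dtri] dopen] := gen_d.
pose ball m (e : R) : set T := [set y | exists x, [/\ D x, f x = m & d x y < e]].
exists (fun n => if unpickle n is Some mk then ball mk.1 (2 ^- mk.2) else set0).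
split=> [n|x A].
  case: unpickle => [[m k]|]/=; last exact: open0.
  rewrite openE => y [x [Dx /= fx]]; set e := 2 ^- k => dxy.
  have xy_gt0 : 0 < e - d x y by rewrite subr_gt0.
  apply: filterS (nbhs_metric_ball gen_d y xy_gt0) => z /= dyz.
  by exists x; split=> //; have := dtri x y z; lra.
move=> /(nbhs_metricP gen_d)[e e0 eA].
have [k ke] : exists k, 2 ^- k < e / 2 by apply: expV2_small; lra.
have k0 : 0 < 2 ^- k :> R by exact: expV2_gt0.
have [y [yx Dy]] : [set y | d x y < 2 ^- k]° `&` D !=set0.
  apply: Ddense; last exact: open_interior.
  by exists x; exact: nbhs_metric_ball.
move/interior_subset : yx => /= dxy.
exists (pickle (f y, k)); rewrite pickleK/=.
  by exists y; rewrite dsym.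
move=> z [y' [Dy' fy' dy'z]]; apply: eA => /=.
have yy' : y' = y by apply: finj; rewrite ?inE.
by have := dtri x y z; move: dy'z; rewrite yy'; lra.
Qed.

(** Members with non-compact closure can be dropped: a member inside a compact
    closed neighbourhood has compact closure, and such members remain available
    around every point. *)
Lemma locally_compact_base (T : topologicalType) (B : nat -> set T) :
  locally_compact [set: T] -> countable_base B ->
  exists2 B' : nat -> set T, countable_base B' & forall n, compact (closure (B' n)).
Proof.
move=> Tlc [Bopen Bbase].
exists (fun n => if `[< compact (closure (B n)) >] then B n else set0).
  split=> [n|x A xA].
    by case: asboolP => // _; exact: open0.
  have [U] := Tlc x I; rewrite withinET => xU [Ucompact Uclosed].
  have [n Bnx BnAU] := Bbase x (A `&` U) (filterI xA xU).
  have Bncompact : compact (closure (B n)).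
    apply: subclosed_compact Ucompact _; first exact: closed_closure.
    rewrite (iffLR (closure_id _) Uclosed); apply: closureS.
    by move=> y /BnAU[].
  by exists n; case: asboolP => // _ y /BnAU[].
move=> n; case: asboolP => // _.
by rewrite closure0; exact: compact0.
Qed.

Lemma compact_exhaustion_mono (T : topologicalType) (K : nat -> set T) :
  compact_exhaustion K -> forall m n, (m <= n)%N -> K m `<=` K n.
Proof.
move=> [_ Kint _] m n /subnK <-; elim: (n - m)%N => // k IH.
by rewrite addSn; apply: (subset_trans IH) => x /Kint/interior_subset.
Qed.

Lemma compact_exhaustion_cover (T : topologicalType) (K : nat -> set T) :
  compact_exhaustion K -> forall x : T, exists n, nbhs x (K n).
Proof.
move=> [_ Kint Kcover] x; have [n _ Knx] : (\bigcup_n K n) x by rewrite Kcover.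
by exists n.+1; exact: Kint.
Qed.

(** The unions [L n] of the first [n] closures have interiors increasing to the
    whole space, so each compact [L n] lies in the interior of a later one;
    iterating this step selects an exhaustion. *)
Lemma locally_compact_hemicompact (T : topologicalType) (B : nat -> set T) :
  countable_base B -> (forall n, compact (closure (B n))) -> hemicompact T.
Proof.
move=> [Bopen Bbase] Bcompact.
pose L n := \big[setU/set0]_(i < n) closure (B i).
have LE n : L n = \bigcup_(i in [set i | (i < n)%N]) closure (B i).
  by rewrite /L -(bigcup_mkord n (fun i => closure (B i))).
have Lcompact n : compact (L n) by apply: bigsetU_compact => i _; exact: Bcompact.
have Lmono m n : (m <= n)%N -> L m `<=` L n.
  by move=> mn; rewrite !LE => x [i /= im ?]; exists i => //=; exact: leq_trans mn.
have BL i : B i `<=` L i.+1.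
  by rewrite LE => x Bx; exists i => //=; exact: subset_closure.
have next n : exists m, (n < m)%N /\ L n `<=` (L m)°.
  have : \forall m \near \oo, L n `<=` (L m)°.
    move/(_ n)/compact_near_coveringP : Lcompact; apply => x _.
    have [i Bix _] := Bbase x setT filterT.
    exists (B i, [set m | (i < m)%N]).
      split=> /=; last exact: nbhs_infty_gt.
      exact: (open_nbhs_nbhs (conj (Bopen i) Bix)).
    move=> [y m] [/= Biy im]; apply: (interiorS (Lmono i.+1 m im)).
    by apply: (interiorS (BL i)); exact: (open_nbhs_nbhs (conj (Bopen i) Biy)).
  move=> /(filterI (nbhs_infty_gt n))[N _ /(_ N)].
  by rewrite /= leqnn => /(_ isT) ?; exists N.
have [g /all_and2[g_gt Lg]] := choice next.
pose phi n := iter n g 0%N.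
have phi_ge n : (n <= phi n)%N.
  by elim: n => // n IH; exact: leq_ltn_trans IH (g_gt _).
exists (L \o phi); split=> [n|n|]; [exact: Lcompact|exact: Lg|].
rewrite -subTset => x _; have [i Bix _] := Bbase x setT filterT.
by exists i.+1 => //; exact: (Lmono _ _ (phi_ge _) _ (BL _ _ Bix)).
Qed.

(** * The compact-open topology *)
Section CompactOpen.
Context {X Y : topologicalType}.

Lemma continuousType_cvgP (F : set_system (continuousType X Y))
    (f : continuousType X Y) : Filter F ->
  (forall (K : set X) (O : set Y), compact K -> open O -> f @` K `<=` O ->
    F [set g : continuousType X Y | g @` K `<=` O]) ->
  F --> f.
Proof.
move=> FF Fsub A; rewrite nbhsE => -[_ [[C Copen <-] Cf]] /filterS; apply.
have /compact_open_cvgP Fco : Filter ((id : continuousType X Y -> (X -> Y)) @ F).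
  exact: fmap_filter.
by have := (Fco f).2 Fsub; apply; apply: open_nbhs_nbhs.
Qed.

Lemma open_compact_sub (K : set X) (O : set Y) : compact K -> open O ->
  open [set g : continuousType X Y | g @` K `<=` O].
Proof.
move=> Kcompact Oopen; exists [set g | g @` K `<=` O] => //.
exact: compact_open_open.
Qed.

End CompactOpen.

(** * The metric of compact convergence *)
Section DistOn.
Context {R : realType} {X Y : topologicalType} {dY : Y -> Y -> R}.
Hypothesis gen_dY : metric_generates dY.
Implicit Types (f g h : continuousType X Y) (K : set X).

Lemma dist_bounded_on K f g : compact K ->
  exists M, forall x, K x -> dY (f x) (g x) <= M.
Proof.
have [[_ _ dsym dtri] _] := gen_dY.
move=> /compact_near_coveringP Kcover.
have : \forall M \near +oo, K `<=` [set x | dY (f x) (g x) <= M].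
  apply: Kcover => x _.
  exists ([set y | dY (f x) (f y) < 1] `&` [set y | dY (g x) (g y) < 1],
          [set M | dY (f x) (g x) + 2 <= M]) => [|[y M] /= [[fxy gxy] xM]].
    split=> /=; last by apply: nbhs_pinfty_ge; exact: num_real.
    apply: filterI.
      exact: (@cts_fun _ _ f x _ (nbhs_metric_ball gen_dY (f x) ltr01)).
    exact: (@cts_fun _ _ g x _ (nbhs_metric_ball gen_dY (g x) ltr01)).
  have := dtri (f y) (f x) (g y); have := dtri (f x) (g x) (g y).
  by rewrite (dsym (f y) (f x)); lra.
by move=> /filter_ex[M KM]; exists M.
Qed.

Lemma dist_on_ub K f g x : compact K -> K x -> dY (f x) (g x) <= dist_on dY K f g.
Proof.
move=> Kcompact Kx; apply: ub_le_sup; last by exists x.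
have [M KM] := dist_bounded_on f g Kcompact.
by exists M => _ [y Ky <-]; exact: KM.
Qed.

Lemma dist_on_le K f g c : 0 <= c ->
  (forall x, K x -> dY (f x) (g x) <= c) -> dist_on dY K f g <= c.
Proof.
move=> c0 Kc; rewrite /dist_on; have [->|/set0P[x Kx]] := eqVneq K set0.
  by rewrite image_set0 sup0.
by apply: ge_sup; [exists (dY (f x) (g x)), x | move=> _ [y Ky <-]; exact: Kc].
Qed.

Lemma dist_on_ge0 K f g : compact K -> 0 <= dist_on dY K f g.
Proof.
have [[d0 _ _ _] _] := gen_dY.
move=> Kcompact; have [K0|/set0P[x Kx]] := eqVneq K set0.
  by rewrite /dist_on K0 image_set0 sup0.
exact: le_trans (dist_on_ub f g Kcompact Kx).
Qed.

Lemma dist_on_mono K K' f g : compact K' -> K `<=` K' ->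
  dist_on dY K f g <= dist_on dY K' f g.
Proof.
move=> K'compact KK'; apply: dist_on_le; first exact: dist_on_ge0.
by move=> x /KK'; exact: dist_on_ub.
Qed.

Lemma dist_on_sym K f g : dist_on dY K f g = dist_on dY K g f.
Proof.
have [[_ _ dsym _] _] := gen_dY.
by rewrite /dist_on; under eq_fun do rewrite dsym.
Qed.

Lemma dist_on_refl K f : compact K -> dist_on dY K f f = 0.
Proof.
move=> Kcompact; apply/eqP; rewrite eq_le dist_on_ge0// andbT.
by apply: dist_on_le => // x _; rewrite (is_metric_refl gen_dY.1).
Qed.

Lemma dist_on_triangle K f g h : compact K ->
  dist_on dY K f h <= dist_on dY K f g + dist_on dY K g h.
Proof.
have [[_ _ _ dtri] _] := gen_dY.
move=> Kcompact; apply: dist_on_le => [|x Kx].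
  by rewrite addr_ge0 ?dist_on_ge0.
by apply: (le_trans (dtri _ (g x) _)); rewrite lerD// dist_on_ub.
Qed.

End DistOn.

Section CompactConvergence.
Context {R : realType} {X Y : topologicalType} {dY : Y -> Y -> R}.
Context {K : nat -> set X}.
Hypothesis gen_dY : metric_generates dY.
Hypothesis K_exhausts : compact_exhaustion K.
Implicit Types (f g h : continuousType X Y).

Let D f g : R := compact_convergence_dist dY K f g.

Let K_compact n : compact (K n). Proof. by case: K_exhausts. Qed.

Let dK_ge0 f g n : 0 <= dist_on dY (K n) f g.
Proof. exact: dist_on_ge0. Qed.

Let dK_mono f g : nondecreasing_seq (fun n => dist_on dY (K n) f g).
Proof.
by move=> m n mn; apply: dist_on_mono => //; exact: compact_exhaustion_mono.
Qed.

Lemma compact_convergence_is_metric : is_metric D.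
Proof.
have [[d0 deq0 _ _] _] := gen_dY.
split=> [f g|f g|f g|f g h].
- exact: weighted_sum_ge0 (dK_ge0 f g) (dK_mono f g).
- split=> [Dfg0|->]; last first.
    rewrite -[RHS]weighted_sum0 /D /compact_convergence_dist.
    by congr weighted_sum; apply/funext => n; exact: dist_on_refl.
  apply/continuousEP => x; apply/deq0/eqP; rewrite eq_le d0 andbT.
  have [n /nbhs_singleton Knx] := compact_exhaustion_cover K_exhausts x.
  rewrite -(weighted_sum_eq0 (dK_ge0 f g) (dK_mono f g) Dfg0 n).
  exact: dist_on_ub.
- rewrite /D /compact_convergence_dist; congr weighted_sum.
  by apply/funext => n; exact: dist_on_sym.
- apply: weighted_sum_subadditive => // n; exact: dist_on_triangle.
Qed.

Lemma compact_convergence_dist_uniform n (e : R) : 0 < e ->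
  exists2 c : R, 0 < c &
    forall f g, D f g < c -> forall x, K n x -> dY (f x) (g x) < e.
Proof.
move=> e0; exists (2 ^- n.+1 * saturate e).
  by rewrite mulr_gt0 ?expV2_gt0 ?saturate_gt0.
move=> f g /(weighted_sum_small (dK_ge0 f g) (dK_mono f g) (ltW e0)) fg x Kx.
by apply: le_lt_trans fg; exact: dist_on_ub.
Qed.

Lemma uniform_compact_convergence_dist (e : R) : 0 < e ->
  exists n, exists2 c : R, 0 < c &
    forall f g, (forall x, K n x -> dY (f x) (g x) < c) -> D f g < e.
Proof.
move=> e0; have e2 : 0 < e / 2 by lra.
have [n ne] := expV2_small e2.
exists n, (e / 2) => // f g fg.
apply: (le_lt_trans (weighted_sum_le n (dK_ge0 f g) (dK_mono f g))).
have : dist_on dY (K n) f g <= e / 2.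
  by apply: dist_on_le => [|x Knx]; exact/ltW/fg || exact: ltW.
by move: ne; rewrite [2 ^- n]expV2S/=; have := @expV2_gt0 R n.+1; lra.
Qed.

Hypothesis eval_cont : continuous (@eval X Y).

(** Evaluation is jointly continuous, so [f] and [g] are close near each point of
    [C] for all [g] in a neighbourhood of [f]; compactness of [C] makes one
    neighbourhood of [f] work for all points. *)
Lemma nbhs_uniform_on (C : set X) f (e : R) : compact C -> 0 < e ->
  nbhs f [set g : continuousType X Y | forall x, C x -> dY (f x) (g x) < e].
Proof.
have [[_ _ dsym dtri] _] := gen_dY.
move=> /compact_near_coveringP Ccover e0; have e2 : 0 < e / 2 by lra.
apply: (Ccover _ (nbhs f)
  (fun (g : continuousType X Y) x => dY (f x) (g x) < e)) => x _.
have fxe := nbhs_metric_ball gen_dY (f x) e2.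
have [[A B] /= [Af Bx] ABe] := @eval_cont (f, x) _ fxe.
exists (B `&` [set y | dY (f x) (f y) < e / 2], A).
  by split=> //=; apply: filterI => //; exact: (@cts_fun _ _ f x _ fxe).
move=> [y g] [/= [By fxy] Ag].
have /= := ABe (g, y) (conj Ag By); rewrite /eval/= => gxy.
by have := dtri (f y) (f x) (g y); rewrite (dsym (f y) (f x)); lra.
Qed.

(** For the converse of [nbhs_uniform_on], the filter of balls around [f] is shown
    to converge to [f] in the compact-open topology. Every point of a compact set
    has some [K n] as a neighbourhood, and closeness on that [K n] suffices near
    that point. *)
Theorem compact_convergence_generates : metric_generates D.
Proof.
have [[_ _ dsym dtri] _] := gen_dY.
apply: metric_generatesP compact_convergence_is_metric _ => f A; split; last first.
  move=> [e e0 eA]; have [n [c c0 nc]] := uniform_compact_convergence_dist e0.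
  apply: filterS (nbhs_uniform_on f (@K_compact n) c0) => g fg.
  by apply: eA; exact: nc.
pose F := filter_from [set e : R | 0 < e] (fun e => [set g | D f g < e]).
have FF : Filter F.
  apply: filter_from_filter; first by exists 1 => /=.
  move=> a b a0 b0; exists (Num.min a b) => [|g /=]; first by rewrite /= lt_min a0.
  by rewrite lt_min => /andP.
suff Ff : F --> f by move=> /Ff.
apply: continuousType_cvgP => C O /compact_near_coveringP Ccover Oopen fCO.
have : \forall g \near F, C `<=` [set x | O ((g : continuousType X Y) x)].
  apply: Ccover => x Cx.
  have /(nbhs_metricP gen_dY)[r r0 rO] : nbhs (f x) O.
    by apply: open_nbhs_nbhs; split=> //; apply: fCO; exists x.
  have r2 : 0 < r / 2 by lra.
  have [n Knx] := compact_exhaustion_cover K_exhausts x.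
  have [c c0 cK] := compact_convergence_dist_uniform n r2.
  exists (K n `&` [set y | dY (f x) (f y) < r / 2], [set g | D f g < c]).
    split=> /=; last by exists c.
    apply: filterI => //.
    exact: (@cts_fun _ _ f x _ (nbhs_metric_ball gen_dY (f x) r2)).
  move=> [y g] /= [[Kny fxy] fg]; apply: rO => /=.
  by have := dtri (f x) (f y) (g y); have := cK f g fg y Kny; lra.
by apply: filterS => g gCO _ [x Cx <-]; exact: gCO.
Qed.

(** A Cauchy sequence converges pointwise, and uniformly on each [K n]. Since every
    point has some [K n] as a neighbourhood, the limit is continuous. *)
Theorem compact_convergence_complete : complete_metric dY -> complete_metric D.
Proof.
have [[_ _ dsym dtri] _] := gen_dY.
move=> Ycomplete u ucauchy.
have unif n (e : R) : 0 < e -> exists N, forall i j, (N <= i)%N -> (N <= j)%N ->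
    forall x, K n x -> dY (u i x) (u j x) < e.
  move=> /(compact_convergence_dist_uniform n)[c c0 cK].
  have [N uN] := ucauchy c c0; exists N => i j Ni Nj.
  by apply: cK; exact: uN.
have ptwise (x : X) : exists l : Y, (fun n => u n x) @ \oo --> l.
  apply: Ycomplete => e e0.
  have [n /nbhs_singleton Knx] := compact_exhaustion_cover K_exhausts x.
  by have [N uN] := unif n e e0; exists N => i j Ni Nj; exact: uN.
have [l ul] := choice ptwise.
have lunif n (e : R) : 0 < e -> exists N, forall i, (N <= i)%N ->
    forall x, K n x -> dY (l x) (u i x) < e.
  move=> e0; have e2 : 0 < e / 2 by lra.
  have [N uN] := unif n _ e2; exists N => i Ni x Knx.
  have /(filterI (nbhs_infty_ge N)) := ul x _ (nbhs_metric_ball gen_dY (l x) e2).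
  move=> /filter_ex[j [/= Nj lj]].
  by have := dtri (l x) (u j x) (u i x); have := uN j i Nj Ni x Knx; lra.
have l_cont : continuous l.
  move=> x A /(nbhs_metricP gen_dY)[e e0 eA]; have e3 : 0 < e / 3 by lra.
  have [n Knx] := compact_exhaustion_cover K_exhausts x.
  have [N lN] := lunif n _ e3.
  have uNe := @cts_fun _ _ (u N) x _ (nbhs_metric_ball gen_dY (u N x) e3).
  apply: filterS (filterI Knx uNe).
  move=> y [Kny /= uxy]; apply: eA => /=.
  have := lN N (leqnn _) x (nbhs_singleton Knx); have := lN N (leqnn _) y Kny.
  have := dtri (l x) (u N x) (l y); have := dtri (u N x) (u N y) (l y).
  by rewrite (dsym (u N y) (l y)); lra.
exists (mkcts l_cont : continuousType X Y).
apply: (metric_cvgP compact_convergence_generates) => e e0.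
have [n [c c0 nc]] := uniform_compact_convergence_dist e0.
have [N lN] := lunif n c c0.
by exists N => // i /= Ni; apply: nc => x Knx; exact: lN.
Qed.

End CompactConvergence.

(** * Sigma-algebras generated by open sets *)
Section SigmaAlgebra.
Context {T : Type} {G : set (set T)}.
Hypothesis sigmaG : sigma_algebra setT G.

Lemma sigma_algebra_setC A : G A -> G (~` A).
Proof. by case: sigmaG => _ GC _; rewrite -setTD; exact: GC. Qed.

Lemma sigma_algebra_setT : G setT.
Proof. by rewrite -setC0; apply: sigma_algebra_setC; case: sigmaG. Qed.

Lemma sigma_algebra_bigcapT (F : nat -> set T) :
  (forall n, G (F n)) -> G (\bigcap_n F n).
Proof.
move=> GF; rewrite -[X in G X]setCK; apply: sigma_algebra_setC.
rewrite setC_bigcap; have [_ _] := sigmaG; apply=> n.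
exact: sigma_algebra_setC.
Qed.

Lemma sigma_algebra_setI A B : G A -> G B -> G (A `&` B).
Proof.
move=> GA GB; rewrite (_ : A `&` B = \bigcap_n (if n == 0%N then A else B)).
  by apply: sigma_algebra_bigcapT => -[|n].
apply/seteqP; split=> [x [Ax Bx] [|n] _ //|x ABx].
by split; [exact: (ABx 0%N) | exact: (ABx 1%N)].
Qed.

Lemma sigma_algebra_countable_bigcap (I : Type) (D : set I) (F : I -> set T) :
  countable D -> (forall i, D i -> G (F i)) -> G (\bigcap_(i in D) F i).
Proof.
move=> /countable_injP[f finj] GF.
rewrite (_ : \bigcap_(i in D) F i =
    \bigcap_n [set t | forall i, D i -> f i = n -> F i t]).
  apply: sigma_algebra_bigcapT => n.
  have [[i [Di fi]]|nD] := pselect (exists i, D i /\ f i = n).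
    rewrite (_ : [set t | _] = F i); first exact: GF.
    apply/seteqP; split=> t /=; first exact.
    move=> Fit j Dj fj; suff -> : j = i by [].
    by apply: finj; rewrite ?inE// fj.
  rewrite (_ : [set t | _] = setT); first exact: sigma_algebra_setT.
  by rewrite -subTset => t _ i Di fi; case: nD; exists i.
apply/seteqP; split=> [t Ft n _ i Di _|t Ft i Di]; first exact: Ft.
exact: (Ft (f i) Logic.I i Di erefl).
Qed.

End SigmaAlgebra.

Lemma sigma_algebra_open (T : topologicalType) (G : set (set T))
    (B : nat -> set T) : sigma_algebra setT G -> countable_base B ->
  (forall n, G (B n)) -> forall U, open U -> G U.
Proof.
move=> [G0 _ Gbigcup] [_ Bbase] GB U Uopen.
rewrite (_ : U = \bigcup_n (if `[< B n `<=` U >] then B n else set0)).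
  by apply: Gbigcup => n; case: asboolP.
apply/seteqP; split=> [x Ux|x [n _]]; last by case: asboolP => // + ?; exact.
have [n Bnx BnU] := Bbase x U (open_nbhs_nbhs (conj Uopen Ux)).
by exists n => //; case: asboolP.
Qed.

Lemma measurable_wrt_generated (T U : Type) (F : set (set T)) (G : set (set U))
    (f : T -> U) : sigma_algebra setT F ->
  (forall B, G B -> F (f @^-1` B)) -> measurable_wrt F <<s G >> f.
Proof.
move=> sigmaF GF B.
suff : <<s G >> `<=` image_set_system setT f F.
  by move=> /[apply]; rewrite /image_set_system/= setTI.
apply: smallest_sub; first exact: sigma_algebra_image.
by move=> A /GF; rewrite /image_set_system/= setTI.
Qed.

Lemma borel_sigma_algebra (T : topologicalType) : sigma_algebra setT (borel T).
Proof. exact: smallest_sigma_algebra. Qed.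

Lemma open_borel (T : topologicalType) (U : set T) : open U -> borel T U.
Proof. by move=> Uopen; exact: sub_sigma_algebra. Qed.

Lemma closed_borel (T : topologicalType) (C : set T) : closed C -> borel T C.
Proof.
move=> Cclosed; rewrite -[C]setCK; apply: (sigma_algebra_setC (borel_sigma_algebra _)).
by apply: open_borel; exact: closed_openC.
Qed.

Lemma continuous_borel (T U : topologicalType) (f : T -> U) :
  continuous f -> measurable_wrt (borel T) (borel U) f.
Proof.
move=> /continuousP fopen; apply: measurable_wrt_generated => [|B /fopen].
  exact: borel_sigma_algebra.
exact: open_borel.
Qed.

(** Every point of [O] lies in an open box inside [O]; shrinking the second side of
    the box to some [B n] puts the first side into [W n]. *)
Lemma open_prod_sigma_algebra (S T : topologicalType) (B : nat -> set T)
    (O : set (S * T)) : countable_base B -> open O ->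
  prod_sigma_algebra (borel S) (borel T) O.
Proof.
move=> [Bopen Bbase] Oopen.
pose W n := \bigcup_(W in [set W : set S | open W /\ W `*` B n `<=` O]) W.
have sigmaP : sigma_algebra setT (prod_sigma_algebra (borel S) (borel T)).
  exact: smallest_sigma_algebra.
rewrite (_ : O = \bigcup_n (W n `*` B n)).
  have [_ _] := sigmaP; apply=> n.
  apply: (sigma_algebra_setI sigmaP); apply: sub_sigma_algebra.
    left; exists (W n); last by rewrite setTI.
    by apply: open_borel; apply: bigcup_open => V [].
  by right; exists (B n); [exact: open_borel | rewrite setTI].
apply/seteqP; split=> [[s t] Ost|[s t] [n _ [[V [_ VBO] Vs] Bnt]]]; last exact: VBO.
have [[P Q] /= [sP tQ] PQO] := open_nbhs_nbhs (conj Oopen Ost).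
have [n Bnt BnQ] := Bbase t Q tQ.
exists n => //; split=> //=; exists P°; last exact: sP.
split; first exact: open_interior.
move=> [s' t'] [/= /interior_subset Ps' /BnQ Qt'].
exact: (PQO (s', t')).
Qed.

(** One point is picked in each nonempty member; the value [None] stands for the
    empty ones. *)
Lemma countable_base_separable (T : topologicalType) (B : nat -> set T) :
  countable_base B -> separable T.
Proof.
move=> [Bopen Bbase].
have /choice[g gB] n : exists o : option T,
    B n !=set0 -> exists2 x, o = Some x & B n x.
  have [[x Bnx]|Bn0] := pselect (B n !=set0); first by exists (Some x); exists x.
  by exists None.
exists [set x | exists n, g n = Some x].
  have /choice[f fg] x : exists n, (exists m, g m = Some x) -> g n = Some x.
    have [[n gn]|ng] := pselect (exists m, g m = Some x); first by exists n.
    by exists 0%N.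
  apply/countable_injP; exists f => x y; rewrite !inE => gx gy fxy.
  by apply: Some_inj; rewrite -(fg _ gx) -(fg _ gy) fxy.
move=> O [x Ox] Oopen.
have [n Bnx BnO] := Bbase x O (open_nbhs_nbhs (conj Oopen Ox)).
have [|y gn Bny] := gB n; first by exists x.
by exists y; split; [exact: BnO | exists n].
Qed.

(** * A countable base of the compact-open topology *)
Section CompactOpenBase.
Context {X Y : topologicalType} {B : nat -> set X} {V : nat -> set Y}.

(** A list of pairs encodes a finite intersection of subbasic sets. *)
Definition compact_open_basic (s : seq (nat * nat)) : set (continuousType X Y) :=
  [set f | forall p, p \in s -> f @` closure (B p.1) `<=` V p.2].

Definition compact_open_base (n : nat) : set (continuousType X Y) :=
  if unpickle n is Some s then compact_open_basic s else set0.

Lemma compact_open_basic_nil : compact_open_basic [::] = setT.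
Proof. by rewrite -subTset. Qed.

Lemma compact_open_basic_cons p s : compact_open_basic (p :: s) =
  [set f : continuousType X Y | f @` closure (B p.1) `<=` V p.2] `&`
  compact_open_basic s.
Proof.
apply/seteqP; split=> [f fps|f [fp fs] q].
  split; first by apply: fps; rewrite mem_head.
  by move=> q qs; apply: fps; rewrite inE qs orbT.
by rewrite inE => /orP[/eqP->|/fs].
Qed.

Hypothesis X_regular : regular_space X.
Hypothesis B_base : countable_base B.
Hypothesis B_compact : forall n, compact (closure (B n)).
Hypothesis V_base : countable_base V.

Lemma open_compact_open_basic s : open (compact_open_basic s).
Proof.
elim: s => [|p s IH]; first by rewrite compact_open_basic_nil; exact: openT.
rewrite compact_open_basic_cons; apply: openI => //.
by apply: open_compact_sub; [exact: B_compact | exact: V_base.1].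
Qed.

(** The basic sets containing [f] generate a filter, and convergence of this
    filter to [f] is tested on a compact set [C] through its points: near [x],
    the single condition that [closure (B i)] is mapped into [V j] is enough, and
    the covering property of [C] gathers finitely many of them. *)
Lemma compact_open_countable_base : countable_base compact_open_base.
Proof.
split=> [n|f A fA].
  rewrite /compact_open_base; case: unpickle => [s|]; last exact: open0.
  exact: open_compact_open_basic.
pose F := filter_from [set s | compact_open_basic s f] compact_open_basic.
have FF : Filter F.
  apply: filter_from_filter; first by exists [::]; rewrite /= compact_open_basic_nil.
  move=> s t /= fs ft; exists (s ++ t) => [p|g gst].
    by rewrite mem_cat => /orP[/fs|/ft].
  by split=> p ps; apply: gst; rewrite mem_cat ps ?orbT.
suff /(_ A fA)[s fs sA] : F --> f.
  by exists (pickle s); rewrite /compact_open_base pickleK.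
apply: continuousType_cvgP => C O /compact_near_coveringP Ccover Oopen fCO.
have : \forall g \near F, C `<=` [set x | O ((g : continuousType X Y) x)].
  apply: Ccover => x Cx.
  have [|j Vjfx VjO] := V_base.2 (f x) O.
    by apply: open_nbhs_nbhs; split=> //; apply: fCO; exists x.
  have fVj : nbhs x (f @^-1` V j).
    by apply: (@cts_fun _ _ f); apply: open_nbhs_nbhs; split=> //; exact: V_base.1.
  have [N xN NVj] := X_regular fVj.
  have [i Bix BiN] := B_base.2 x N xN.
  exists (B i, compact_open_basic [:: (i, j)]) => [|[y g] /= [Biy gij]].
    split=> /=; first by apply: open_nbhs_nbhs; split=> //; exact: B_base.1.
    exists [:: (i, j)] => // p; rewrite inE => /eqP-> _ [y yB <-].
    by apply: NVj; exact: closureS BiN _ yB.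
  apply: VjO; apply: (gij (i, j)); first by rewrite mem_head.
  by exists y => //; exact: subset_closure.
by apply: filterS => g gCO _ [x Cx <-]; exact: gCO.
Qed.

End CompactOpenBase.

Lemma dense_closure_open (T : topologicalType) (D U : set T) :
  dense D -> open U -> closure U `<=` closure (D `&` U).
Proof.
move=> Ddense Uopen; rewrite (iffLR (closure_id _) (@closed_closure _ (D `&` U))).
apply: closureS => x Ux A xA.
have [y [[/interior_subset Ay Uy] Dy]] : (A° `&` U) `&` D !=set0.
  apply: Ddense; last by apply: openI => //; exact: open_interior.
  by exists x.
by exists y.
Qed.

(** * The Borel sigma-algebra of the function space *)
Section BorelTrace.
Context {R : realType} {X Y : topologicalType} {dY : Y -> Y -> R}.
Hypothesis gen_dY : metric_generates dY.

(** For open [V], these closed sets increase to [V] as [e] decreases to [0]. *)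
Let erosion (V : set Y) (e : R) : set Y := [set y | [set z | dY y z < e] `<=` V].

Lemma closed_erosion (V : set Y) (e : R) : closed (erosion V e).
Proof.
have [[_ _ dsym dtri] _] := gen_dY.
rewrite -openC openE => y /existsNP[z /not_implyP[/= yz nVz]].
have yz0 : 0 < e - dY y z by rewrite subr_gt0.
apply: filterS (nbhs_metric_ball gen_dY y yz0) => y' /= yy' /(_ z) y'V.
by apply/nVz/y'V; have := dtri y' y z; rewrite /= (dsym y' y); lra.
Qed.

Lemma image_compact_sub_erosion (f : continuousType X Y) (C : set X) (V : set Y) :
  compact C -> open V -> f @` C `<=` V ->
  exists n, f @` C `<=` erosion V (2 ^- n).
Proof.
have [[_ _ dsym dtri] _] := gen_dY.
move=> /compact_near_coveringP Ccover Vopen fCV.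
have : \forall e \near 0^'+, C `<=` [set x | erosion V e (f x)].
  apply: Ccover => x Cx.
  have /(nbhs_metricP gen_dY)[r r0 rV] : nbhs (f x) V.
    by apply: open_nbhs_nbhs; split=> //; apply: fCV; exists x.
  have r2 : 0 < r / 2 by lra.
  exists ([set y | dY (f x) (f y) < r / 2], [set e | e < r / 2]).
    split=> /=; last exact: nbhs_right_lt.
    exact: (@cts_fun _ _ f x _ (nbhs_metric_ball gen_dY (f x) r2)).
  move=> [y e] /= [fxy er] z /= fyz; apply: rV => /=.
  by have := dtri (f x) (f y) z; lra.
move=> /(filterI (nbhs_right_gt 0))/filter_ex[e [e0 eC]].
have [n ne] := expV2_small e0.
exists n => _ [x Cx <-] z /= fxz; apply: (eC x Cx) => /=.
exact: lt_trans ne.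
Qed.

(** Compactness of [closure B] provides a margin [2 ^- n] valid at all its points;
    as the eroded set is closed, the margin at the points of [D `&` B] passes to
    all of [closure B]. *)
Lemma compact_open_subE (D B : set X) (V : set Y) :
  dense D -> open B -> compact (closure B) -> open V ->
  [set f : continuousType X Y | f @` closure B `<=` V] =
  \bigcup_n \bigcap_(x in D `&` B)
    [set f : continuousType X Y | erosion V (2 ^- n) (f x)].
Proof.
move=> Ddense Bopen Bcompact Vopen; apply/seteqP; split=> f /=.
  move=> /(image_compact_sub_erosion Bcompact Vopen)[n fn].
  exists n => // x [_ Bx]; apply: fn; exists x => //; exact: subset_closure.
move=> [n _ fn] _ [x Bx <-].
have : erosion V (2 ^- n) (f x).
  have : closed (f @^-1` erosion V (2 ^- n)).
    by apply: preimage_closed => [? _|]; [exact: cts_fun | exact: closed_erosion].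
  apply; apply: closureS (dense_closure_open Ddense Bopen Bx).
  by move=> y /fn.
by apply; rewrite /= (is_metric_refl gen_dY.1) expV2_gt0.
Qed.

Lemma trace_eval_borel x (C : set Y) : borel Y C ->
  trace_continuous (power_sigma_algebra X (borel Y))
    [set f : continuousType X Y | C (f x)].
Proof.
move=> BC; exists [set h | C (h x)]; last by rewrite setTI.
by apply: sub_sigma_algebra; exists x => //; exists C; rewrite ?setTI.
Qed.

Lemma eval_at_continuous (x : X) : continuous (fun f : continuousType X Y => f x).
Proof.
apply/continuousP => O Oopen.
rewrite (_ : _ @^-1` O = [set f : continuousType X Y | f @` [set x] `<=` O]).
  by apply: open_compact_sub => //; exact: compact_set1.
by apply/seteqP; split=> f /=; rewrite image_set1 sub1set inE.
Qed.

Theorem borel_continuousType (B : nat -> set X) (V : nat -> set Y) :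
  separable X -> regular_space X ->
  countable_base B -> (forall n, compact (closure (B n))) -> countable_base V ->
  borel (continuousType X Y) =
    trace_continuous (power_sigma_algebra X (borel Y)).
Proof.
move=> [D Dcountable Ddense] Xregular B_base B_compact V_base.
have sigmaT : sigma_algebra setT
    (@trace_continuous X Y (power_sigma_algebra X (borel Y))).
  by apply: sigma_algebra_preimage; exact: smallest_sigma_algebra.
apply/seteqP; split.
  apply: smallest_sub => // U.
  apply: (sigma_algebra_open sigmaT
    (compact_open_countable_base Xregular B_base B_compact V_base)) => n.
  rewrite /compact_open_base; case: unpickle => [s|]; last by case: sigmaT.
  elim: s => [|p s IH].
    by rewrite compact_open_basic_nil; exact: sigma_algebra_setT.
  rewrite compact_open_basic_cons; apply: (sigma_algebra_setI sigmaT) => //.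
  rewrite (compact_open_subE Ddense (B_base.1 p.1) (B_compact p.1) (V_base.1 p.2)).
  have [_ _] := sigmaT; apply=> m.
  apply: (sigma_algebra_countable_bigcap sigmaT) => [|x _].
    by apply: sub_countable Dcountable; apply: subset_card_le => ? [].
  by apply: trace_eval_borel; apply: closed_borel; exact: closed_erosion.
move=> _ [A Apower <-]; rewrite setTI; move: A Apower.
apply: measurable_wrt_generated; first exact: borel_sigma_algebra.
move=> _ [x _ [C BC <-]]; rewrite setTI.
exact: (continuous_borel (@eval_at_continuous x) BC).
Qed.

End BorelTrace.

(** * Evaluation and topology of the function space *)

Theorem theoremB1 (R : realType) (X Y : topologicalType)
    (X_locally_compact : locally_compact [set: X])
    (X_separable : separable X)
    (X_metrizable : metrizable R X)
    (Y_polish : polish R Y) :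
  [/\ (* (i) *)
      [/\ continuous (@eval X Y),
          measurable_wrt (borel (continuousType X Y * X)%type) (borel Y)
            (@eval X Y) &
          measurable_wrt
            (prod_sigma_algebra (borel (continuousType X Y)) (borel X))
            (borel Y) (@eval X Y)],
      (* (ii) *)
      [/\ hemicompact X,
          polish R (continuousType X Y) &
          forall (dY : Y -> Y -> R) (K : nat -> set X),
            metric_generates dY -> compact_exhaustion K ->
            metric_generates (compact_convergence_dist dY K)] &
      (* (iii) *)
      borel (continuousType X Y) =
        trace_continuous (power_sigma_algebra X (borel Y))].
Proof.
have [dX gen_dX] := X_metrizable.
have [Y_separable [dY [gen_dY Y_complete]]] := Y_polish.
have X_regular := metric_regular gen_dX.
have eval_cont : continuous (@eval X Y) by exact: eval_continuous.
have [B0 B0_base] := separable_metrizable_base X_separable X_metrizable.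
have [B B_base B_compact] := locally_compact_base X_locally_compact B0_base.
have [V V_base] : exists V : nat -> set Y, countable_base V.
  by apply: (@separable_metrizable_base R) => //; exists dY.
have X_hemicompact := locally_compact_hemicompact B_base B_compact.
split.
- split=> //; first exact: continuous_borel.
  apply: measurable_wrt_generated; first exact: smallest_sigma_algebra.
  move=> U Uopen; apply: (open_prod_sigma_algebra B_base).
  by move/continuousP : eval_cont; exact.
- split=> //.
    split.
      exact: countable_base_separable
        (compact_open_countable_base X_regular B_base B_compact V_base).
    have [K K_exhausts] := X_hemicompact.
    exists (compact_convergence_dist dY K); split.
      exact: compact_convergence_generates.
    exact: compact_convergence_complete.
  move=> dY' K gen_dY' K_exhausts.
  exact: compact_convergence_generates.
- exact: (borel_continuousType gen_dY X_separable X_regular B_base B_compact V_base).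
Qed.
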